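(* Let $\lambda>0$. The following are equivalent for a function $f\in C^\infty((0,\infty))$. (i) $f$ is a generalized Stieltjes function of order $\lambda$; (ii) $c_k^{\lambda}(f)$ is completely monotonic for all $k\geq 0$; (iii) $T_{n,k}^{\lambda}(f)\geq 0$ on $(0,\infty)$ for all $n\geq 0$ and all $k\geq 0$.
   Context: A function $f:(0,\infty)\to\mathbb R$ is a generalized Stieltjes function of order $\lambda>0$ if $$f(x)=\int_0^{\infty}\frac{d\mu(t)}{(x+t)^{\lambda}}+c,\quad x>0,$$ where $\mu$ is a positive measure on $[0,\infty)$ making the integral converge for $x>0$ and $c\geq 0$. A function $g\in C^\infty((0,\infty))$ is completely monotonic if $(-1)^ng^{(n)}(x)\geq 0$ for all $n\geq 0$ and $x>0$. For integers $n,k\geq 0$ and $f\in C^\infty((0,\infty))$, $$T_{n,k}^{\lambda}(f)(x)=(-1)^nx^{-(n+\lambda-1)}\left(x^{k+n+\lambda-1}f^{(n)}(x)\right)^{(k)},\qquad c_k^{\lambda}(f)(x)=x^{1-\lambda}\left(x^{\lambda-1+k}f(x)\right)^{(k)},$$ where $^{(k)}$ denotes the $k$-th derivative. *)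

(* Defs.v *)
From HB Require Import structures.
From mathcomp Require Import all_boot all_order all_algebra.
From mathcomp Require Import all_classical all_reals all_analysis.
Set Implicit Arguments.
Unset Strict Implicit.
Unset Printing Implicit Defensive.
Import Order.TTheory GRing.Theory Num.Theory.
Import numFieldNormedType.Exports.
Local Open Scope classical_set_scope.
Local Open Scope ring_scope.

(* Functions on (0, +oo) are represented by total functions R -> R.  Every
   notion below looks at its function arguments only at positive points: the
   n-th derivative at x > 0 depends only on the values near x, so the junk
   values on (-oo, 0] are irrelevant. *)

(* Continuity of each derivative is implied by the existence of the next. *)
Definition smooth_on_pos (R : realType) (f : R -> R) : Prop :=
  forall (n : nat) (x : R), 0 < x -> derivable (derive1n n f) x 1.

(* A positive measure on [0, +oo) is given by a Borel measure on R of which only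
   the restriction to [0, +oo) is used.  No finiteness is assumed on mu beyond
   the convergence of the integrals. *)
Definition generalized_stieltjes (R : realType) (lambda : R) (f : R -> R) :
    Prop :=
  exists (mu : {measure set (measurableTypeR R) -> \bar R}) (c : R),
    0 <= c /\
    forall x : R, 0 < x ->
      mu.-integrable `[0, +oo[ (fun t : R => (((x + t) `^ lambda)^-1)%:E) /\
      f x = (\int[mu]_(t in `[0, +oo[) ((x + t) `^ lambda)^-1) + c.

Definition completely_monotonic (R : realType) (g : R -> R) : Prop :=
  smooth_on_pos g /\
  forall (n : nat) (x : R), 0 < x -> 0 <= (-1) ^+ n * derive1n n g x.

Definition T_op (R : realType) (lambda : R) (n k : nat) (f : R -> R) (x : R) :
    R :=
  (-1) ^+ n * x `^ (- (n%:R + lambda - 1)) *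
  derive1n k (fun y : R => y `^ (k%:R + n%:R + lambda - 1) * derive1n n f y) x.

Definition c_op (R : realType) (lambda : R) (k : nat) (f : R -> R) (x : R) : R :=
  x `^ (1 - lambda) * derive1n k (fun y : R => y `^ (lambda - 1 + k%:R) * f y) x.

(* Main.v *)
Require Import Defs.
From HB Require Import structures.
From mathcomp Require Import all_boot all_order all_algebra.
From mathcomp Require Import zify ring lra.
From mathcomp Require Import all_classical all_reals all_analysis.
From mathcomp Require Import measurable_realfun.
Set Implicit Arguments.
Unset Strict Implicit.
Unset Printing Implicit Defensive.
Import Order.TTheory GRing.Theory Num.Theory.
Import numFieldNormedType.Exports.
Local Open Scope classical_set_scope.
Local Open Scope ring_scope.

(* On (0, +oo) one has T_{n,k} f = (-1)^n (c_k f)^(n), because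
   c_{k+1} f = x (c_k f)' + (lambda + k) c_k f and (c_k^lambda g)' =
   c_k^{lambda+1} g'; hence (ii) and (iii) are equivalent.  If
   f = c + \int (x+t)^(-lambda) dmu, then
   c_k f = (lambda)_k (c + \int t^k (x+t)^(-lambda-k) dmu), so (i) implies (ii).

   For (iii) -> (i), the numbers h n k = T_{n,k} f (1) / (lambda)_{n+k} are
   nonnegative and satisfy h n k = h (n+1) k + h n (k+1), so h n 0 is a Hausdorff
   moment sequence: h n 0 = \int_0^m q(s)^n ds for a nondecreasing q with values
   in [0, 1].  The image under t = 1/q - 1 of the measure q^(-lambda) ds, with
   the mass of {q = 0} as the constant c, yields a generalized Stieltjes function
   with the same derivatives at 1 as f.  Both functions are completely monotonic,
   hence real analytic, and therefore equal. *)

(** * Derivatives on the positive half-line *)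

Lemma eq_pos_derive1n (R : realType) (f g : R -> R) :
  (forall x : R, 0 < x -> f x = g x) ->
  forall (n : nat) (x : R), 0 < x -> derive1n n f x = derive1n n g x.
Proof.
move=> fg; elim=> [|n IHn] x x0; first exact: fg.
rewrite !derive1nS !derive1E; apply: near_eq_derive.
by near=> y; apply: IHn; near: y; exact: lt_nbhsr.
Unshelve. all: by end_near. Qed.

Lemma eq_pos_smooth (R : realType) (f g : R -> R) :
  (forall x : R, 0 < x -> f x = g x) -> smooth_on_pos f -> smooth_on_pos g.
Proof.
move=> fg sf n x x0; apply: (@near_eq_derivable _ _ _ (derive1n n f)); last exact: sf.
near=> y; apply: eq_pos_derive1n => //; near: y; exact: lt_nbhsr.
Unshelve. all: by end_near. Qed.

Lemma smooth_is_derive (R : realType) (f : R -> R) n (x : R) :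
  smooth_on_pos f -> 0 < x -> is_derive x 1 (derive1n n f) (derive1n n.+1 f x).
Proof.
by move=> sf x0; apply: DeriveDef; [exact: sf|rewrite derive1nS derive1E].
Qed.

Lemma smooth_derive1n (R : realType) (f : R -> R) n :
  smooth_on_pos f -> smooth_on_pos (derive1n n f).
Proof.
move=> sf m x x0; rewrite /derive1n -iterD; exact: (sf (m + n)%N).
Qed.

Arguments smooth_derive1n {R f} n.
Arguments smooth_is_derive {R f} n {x}.

(** Closed forms of iterated derivatives are obtained by guessing the whole sequence [F] and
    checking a single differentiation step; smoothness comes with it. *)
Lemma is_derive_tower (R : realType) (F : nat -> R -> R) :
  (forall (n : nat) (x : R), 0 < x -> is_derive x 1 (F n) (F n.+1 x)) ->
  smooth_on_pos (F 0) /\ forall (n : nat) (x : R), 0 < x -> derive1n n (F 0) x = F n x.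
Proof.
move=> dF.
have FE (n : nat) (x : R) : 0 < x -> derive1n n (F 0) x = F n x.
  elim: n x => // n IHn x x0; rewrite derive1nS derive1E.
  have [_ <-] := dF n x x0; apply: near_eq_derive.
  by near=> y; apply: IHn; near: y; exact: lt_nbhsr.
split=> // n x x0; apply: (@near_eq_derivable _ _ _ (F n)).
  by near=> y; rewrite FE//; near: y; exact: lt_nbhsr.
by have [] := dF n x x0.
Unshelve. all: by end_near. Qed.

Lemma smoothD (R : realType) (f g : R -> R) :
  smooth_on_pos f -> smooth_on_pos g -> smooth_on_pos (f \+ g) /\
  forall (n : nat) (x : R), 0 < x -> derive1n n (f \+ g) x = derive1n n f x + derive1n n g x.
Proof.
move=> sf sg.
apply: (@is_derive_tower _ (fun n x => derive1n n f x + derive1n n g x)) => n x x0.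
have := smooth_is_derive n sf x0; have := smooth_is_derive n sg x0 => dg df.
exact: is_deriveD.
Qed.

Lemma smoothZ (R : realType) (c : R) (f : R -> R) :
  smooth_on_pos f -> smooth_on_pos (fun x => c * f x) /\
  forall (n : nat) (x : R), 0 < x -> derive1n n (fun x => c * f x) x = c * derive1n n f x.
Proof.
move=> sf; apply: (@is_derive_tower _ (fun n x => c * derive1n n f x)) => n x x0.
have df := smooth_is_derive n sf x0.
exact: (is_deriveZ c df).
Qed.

(** The order of differentiation is lowered for all pairs at once: (f g)' = f' g + f g', and both
    products fall under the induction hypothesis. All lower orders are needed to split the iterated
    derivative of this sum. *)
Lemma smoothM (R : realType) (f g : R -> R) :
  smooth_on_pos f -> smooth_on_pos g -> smooth_on_pos (f \* g).
Proof.
move=> + + n; elim/ltn_ind: n f g => -[_|n IHn] f g sf sg x x0.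
  by apply: derivableM; [exact: (sf 0)|exact: (sg 0)].
pose F (y : R) := derive1 f y * g y + f y * derive1 g y.
have FE y : 0 < y -> derive1 (f \* g) y = F y.
  move=> y0; rewrite derive1E.
  have := is_deriveM (smooth_is_derive 0 sf y0) (smooth_is_derive 0 sg y0).
  by move=> [_ ->]; rewrite /F /GRing.scale/= addrC mulrC.
have sf' := smooth_derive1n 1 sf.
have sg' := smooth_derive1n 1 sg.
suff dF : derivable (derive1n n F) x 1.
  rewrite derive1Sn; apply: near_eq_derivable dF.
  near=> y; apply: eq_pos_derive1n => [z z0|]; first by rewrite FE.
  by near: y; exact: lt_nbhsr.
have D1 m y : (m <= n)%N -> 0 < y -> derivable (derive1n m (derive1 f \* g)) y 1.
  by move=> mn y0; exact: (IHn m mn _ _ sf' sg y y0).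
have D2 m y : (m <= n)%N -> 0 < y -> derivable (derive1n m (f \* derive1 g)) y 1.
  by move=> mn y0; exact: (IHn m mn _ _ sf sg' y y0).
have FE' (m : nat) : (m <= n)%N -> forall y : R, 0 < y -> derive1n m F y =
   derive1n m (derive1 f \* g) y + derive1n m (f \* derive1 g) y.
  elim: m => // m IHm mn y y0; rewrite !derive1nS !derive1E.
  rewrite (@near_eq_derive _ _ _ _
    (derive1n m (derive1 f \* g) \+ derive1n m (f \* derive1 g))).
    by rewrite deriveD; [|exact: D1 (ltnW mn) y0|exact: D2 (ltnW mn) y0].
  near=> z; apply: IHm; first exact: ltnW.
  by near: z; exact: lt_nbhsr.
apply: (@near_eq_derivable _ _ _
    (derive1n n (derive1 f \* g) \+ derive1n n (f \* derive1 g))).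
  by near=> z; rewrite FE'//; near: z; exact: lt_nbhsr.
exact: derivableD (D1 _ _ (leqnn n) x0) (D2 _ _ (leqnn n) x0).
Unshelve. all: by end_near. Qed.

Lemma smooth_powR (R : realType) (a : R) :
  smooth_on_pos (fun x : R => x `^ a).
Proof.
pose F n (x : R) := (\prod_(i < n) (a - i%:R)) * x `^ (a - n%:R).
have [|sF _] := @is_derive_tower _ F.
  move=> n x x0; rewrite /F big_ord_recr/=.
  have := is_deriveZ (\prod_(i < n) (a - i%:R)) (is_derive1_powR (a - n%:R) x0).
  move=> /is_derive_eq; apply; rewrite /GRing.scale/= -mulrA.
  by congr (_ * (_ * _ `^ _)); rewrite -natr1; ring.
apply: eq_pos_smooth sF => x x0.
by rewrite /F big_ord0 mul1r subr0.
Qed.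

Lemma smooth_id (R : realType) : smooth_on_pos (fun x : R => x).
Proof.
by apply: eq_pos_smooth (@smooth_powR _ 1) => x x0; rewrite powRr1// ltW.
Qed.

(** Leibniz rule, cut after two terms because y has no second derivative. At n = 0 the truncated
    [n.-1] carries the coefficient 0. *)
Lemma derive1n_mulid (R : realType) (g : R -> R) : smooth_on_pos g ->
  forall (n : nat) (x : R), 0 < x ->
  derive1n n (fun y => y * g y) x = x * derive1n n g x + n%:R * derive1n n.-1 g x.
Proof.
move=> sg; pose F n (x : R) := x * derive1n n g x + n%:R * derive1n n.-1 g x.
have [|_ FE] := @is_derive_tower _ F.
  move=> n x x0; rewrite /F.
  have dg := smooth_is_derive n sg x0.
  have dg' := smooth_is_derive n.-1 sg x0.
  have := is_deriveD (is_deriveM (is_derive_id x (1 : R)) dg) (is_deriveZ n%:R dg').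
  move=> /is_derive_eq; apply; rewrite /GRing.scale/=.
  case: n {dg dg'} => [|n] /=; first by rewrite mul0r; ring.
  by rewrite -!natr1; ring.
move=> n x x0; rewrite -[RHS]/(F n x) -FE//; apply: eq_pos_derive1n => // y y0.
by rewrite /F/= mul0r addr0.
Qed.

Lemma gt0_powRD (R : realType) (x r s : R) : 0 < x ->
  x `^ (r + s) = x `^ r * x `^ s.
Proof. by move=> x0; rewrite powRD// (gt_eqF x0) implybT. Qed.

(** * Recursions for the operators c_k and T_{n,k} *)

Section c_op_theory.
Variable R : realType.
Implicit Types (f g : R -> R) (a x : R).

Lemma smooth_c_op a k f : smooth_on_pos f -> smooth_on_pos (c_op a k f).
Proof.
move=> sf; apply: smoothM; first exact: smooth_powR.
exact: smooth_derive1n (smoothM (@smooth_powR _ _) sf).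
Qed.

Arguments smooth_c_op a k {f}.

Lemma c_op0 a f x : 0 < x -> c_op a 0 f x = f x.
Proof.
move=> x0; rewrite /c_op/= addr0 mulrA -gt0_powRD//.
by rewrite (_ : 1 - a + (a - 1) = 0) ?powRr0 ?mul1r//; ring.
Qed.

(** With g = y^(a-1+k) f, the left side is x^(1-a) (y g)^(k+1) = x^(1-a) (x g^(k+1) + (k+1) g^(k)).
    Differentiating the prefactor of c_k f contributes 1 - a, and a + k = (k+1) - (1-a). *)
Lemma c_opS a k f x : smooth_on_pos f -> 0 < x ->
  c_op a k.+1 f x = x * derive1 (c_op a k f) x + (a + k%:R) * c_op a k f x.
Proof.
move=> sf x0; rewrite /c_op.
set g := fun y : R => y `^ (a - 1 + k%:R) * f y.
have sg : smooth_on_pos g := smoothM (@smooth_powR _ _) sf.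
rewrite (@eq_pos_derive1n _ _ (fun y => y * g y)) => [|y y0|//]; last first.
  rewrite /g mulrA; congr (_ * _).
  rewrite -[X in _ = X * _]powRr1 ?(ltW y0)// -gt0_powRD//.
  by congr (_ `^ _); rewrite -natr1; ring.
rewrite derive1n_mulid// [k.+1.-1]/=.
have [_] := is_deriveM (is_derive1_powR (1 - a) x0) (smooth_is_derive k sg x0).
rewrite -derive1E => ->; rewrite /GRing.scale.
move: (derive1n k.+1 g x) => /= u.
have -> : 1 - a - 1 = - a by ring.
have -> : x `^ (1 - a) = x * x `^ (- a).
  rewrite -[X in _ = X * _]powRr1 ?(ltW x0)// -gt0_powRD//.
by rewrite -natr1; ring.
Qed.

(** Differentiating x u' + (a+k) u gives x u'' + (a+1+k) u', which is the same recursion for u' with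
    a + 1 in place of a. *)
Lemma derive1_c_op a k f x : smooth_on_pos f -> 0 < x ->
  derive1 (c_op a k f) x = c_op (a + 1) k (derive1 f) x.
Proof.
move=> sf; elim: k x => [|k IHk] x x0.
  rewrite c_op0//.
  exact: (@eq_pos_derive1n _ _ _ (fun y y0 => c_op0 a f y0) 1%N).
have su := smooth_c_op a k sf.
rewrite (c_opS _ _ (smooth_derive1n 1 sf) x0).
rewrite -[LHS]/(derive1n 1 _ x).
rewrite (@eq_pos_derive1n _ _ ((fun y => y * derive1 (c_op a k f) y) \+
  (fun y => (a + k%:R) * c_op a k f y)) (fun y y0 => c_opS a k sf y0) _ _ x0).
have sd := smooth_derive1n 1 su.
have [s1 e1] := smoothZ (a + k%:R) su.
have s2 : smooth_on_pos (fun y => y * derive1 (c_op a k f) y).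
  exact: smoothM (@smooth_id R) sd.
have [_ ->] := smoothD s2 s1; last exact: x0.
rewrite (e1 1%N _ x0) (derive1n_mulid sd 1%N x0)/=.
have -> : derive1 (derive1 (c_op a k f)) x =
    derive1 (c_op (a + 1) k (derive1 f)) x.
  exact: (@eq_pos_derive1n _ _ _ IHk 1%N).
by rewrite (IHk _ x0); ring.
Qed.

Lemma derive1n_c_op a k f n x : smooth_on_pos f -> 0 < x ->
  derive1n n (c_op a k f) x = c_op (a + n%:R) k (derive1n n f) x.
Proof.
move=> sf; elim: n x => [|n IHn] x x0; first by rewrite addr0.
rewrite -[LHS]/(derive1n 1 (derive1n n (c_op a k f)) x).
rewrite (@eq_pos_derive1n _ _ _ IHn 1%N _ x0)/=.
rewrite (derive1_c_op _ _ (smooth_derive1n n sf) x0).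
by congr (c_op _ _ _ _); rewrite -natr1 addrA.
Qed.

(** The powers in T_{n,k} f are exactly those of c_k at parameter a + n applied to f^(n). *)
Lemma T_opE a n k f x : smooth_on_pos f -> 0 < x ->
  T_op a n k f x = (-1) ^+ n * derive1n n (c_op a k f) x.
Proof.
move=> sf x0; rewrite (derive1n_c_op _ _ _ sf x0) /T_op /c_op -mulrA.
congr (_ * (_ `^ _ * _)); first by ring.
by congr (derive1n _ _ _); apply/funext => y; congr (_ `^ _ * _); ring.
Qed.

(** At x = 1, after division by (a)_{n+k+1}, this becomes the Pascal-type relation that makes the
    values a Hausdorff moment sequence. *)
Lemma T_opS a n k f x : smooth_on_pos f -> 0 < x ->
  T_op a n k.+1 f x = (a + (n + k)%:R) * T_op a n k f x - x * T_op a n.+1 k f x.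
Proof.
move=> sf x0; rewrite !(T_opE _ _ _ sf x0).
rewrite (derive1n_c_op a k.+1 n sf x0).
rewrite (c_opS _ _ (smooth_derive1n n sf) x0) -(derive1n_c_op _ _ _ sf x0).
have -> : derive1 (c_op (a + n%:R) k (derive1n n f)) x =
    derive1n n.+1 (c_op a k f) x.
  apply/esym; apply: (@eq_pos_derive1n _ _ _ _ 1%N) => // y y0.
  exact: derive1n_c_op.
by rewrite natrD exprS; ring.
Qed.

End c_op_theory.

(** * Analyticity of completely monotonic functions *)

Section taylor.
Variable R : realType.
Implicit Types (f g : R -> R) (a x y z : R).

(** The expansion point y varies while x is fixed. Differentiating (x - y)^i in one term cancels the
    derivative of the coefficient in the previous term, so only the top term survives. *)
Lemma is_derive_taylor_sum g x y N : smooth_on_pos g -> 0 < y ->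
  is_derive y 1 (fun y => \sum_(i < N.+1) derive1n i g y * (x - y) ^+ i / i`!%:R)
    (derive1n N.+1 g y * (x - y) ^+ N / N`!%:R).
Proof.
move=> sg y0; elim: N => [|N IHN].
  have d := smooth_is_derive 0 sg y0.
  rewrite expr0 mulr1 fact0 divr1.
  apply: (@near_eq_is_derive _ _ _ g) d; near=> z.
  by rewrite big_ord1 expr0 mulr1 fact0 divr1.
have dg := smooth_is_derive N.+1 sg y0.
have dx : is_derive y (1 : R) (fun y => x - y) (-1).
  have := is_deriveB (is_derive_cst x y (1 : R)) (is_derive_id y (1 : R)).
  by rewrite sub0r.
have := is_deriveD IHN
  (is_deriveM (is_deriveM dg (is_deriveX N.+1 dx)) (is_derive_cst (N.+1`!%:R^-1 : R) y 1)).
move=> d; apply: is_derive_eq.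
  apply: (@near_eq_is_derive _ _ _ _ _ _ _ _ _ d); near=> z.
  by rewrite [RHS]big_ord_recr/= !fctE.
rewrite /GRing.scale/= !fctE factS natrM.
have : (N`!%:R : R) != 0 by rewrite pnatr_eq0 -lt0n fact_gt0.
have : (N.+1%:R : R) != 0 by rewrite pnatr_eq0.
rewrite -!/(derive1n _ g).
move: (derive1n N.+1 g y) (derive1n N.+2 g y) => u v.
move: (N`!%:R : R) (N.+1%:R : R) => p q q0 p0.
rewrite !exprS.
by field; rewrite p0 q0.
Unshelve. all: by end_near. Qed.

(* The Cauchy form of the remainder works for x on either side of a. *)
Lemma taylor_cauchy g a x N : smooth_on_pos g -> 0 < a -> 0 < x ->
  exists2 c, Num.min a x <= c <= Num.max a x &
  g x = \sum_(i < N.+1) derive1n i g a * (x - a) ^+ i / i`!%:R +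
        derive1n N.+1 g c * (x - c) ^+ N / N`!%:R * (x - a).
Proof.
move=> sg a0 x0.
(* [P] equals g x at y = x and the Taylor polynomial at y = a; the mean value theorem for [P] yields
   the remainder. *)
set P := fun y => \sum_(i < N.+1) derive1n i g y * (x - y) ^+ i / i`!%:R.
have dP y : 0 < y -> is_derive y 1 P (derive1n N.+1 g y * (x - y) ^+ N / N`!%:R).
  exact: is_derive_taylor_sum.
have Px : P x = g x.
  rewrite /P big_ord_recl/= expr0 mulr1 fact0 divr1 big1 ?addr0// => i _.
  by rewrite subrr expr0n/= mulr0 mul0r.
have mvt u v : 0 < u -> u <= v -> exists2 c, c \in `[u, v] &
    P v - P u = derive1n N.+1 g c * (x - c) ^+ N / N`!%:R * (v - u).
  move=> u0 uv; apply: (MVT_segment uv) => [y /itvP yuv|].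
    by apply: dP; rewrite (lt_trans u0)// yuv.
  apply: derivable_within_continuous => y; rewrite in_itv/= => /andP[uy _].
  by have [] := dP y (lt_le_trans u0 uy).
rewrite -Px; have [ax|xa] := leP a x.
  have [c] := mvt _ _ a0 ax; rewrite in_itv/= => acx E.
  by exists c => //; rewrite -E addrC subrK.
have [c] := mvt _ _ x0 (ltW xa); rewrite in_itv/= => acx E.
exists c => //; rewrite -[X in _ = _ + X]opprK -mulrN opprB -E opprB.
by rewrite addrC subrK.
Qed.

End taylor.

Section completely_monotonic_theory.
Variable R : realType.
Implicit Types (f g : R -> R) (a x y z : R).

Lemma completely_monotonic_derive1n f n : completely_monotonic f ->
  completely_monotonic (fun x => (-1) ^+ n * derive1n n f x).
Proof.
move=> [sf f0]; have [s e] := smoothZ ((-1) ^+ n) (smooth_derive1n n sf).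
split=> // m x x0; rewrite e// mulrA -exprD.
by rewrite -[derive1n m _ x]/(derive1n m (derive1n n f) x) /derive1n -iterD; exact: f0.
Qed.

(** In the Taylor expansion at y evaluated at a point z to its left, the sign of (z - y)^i matches
    that of the i-th derivative. All terms and the remainder are nonnegative, so each term is at
    most f z. *)
Lemma completely_monotonic_derive1n_le f n z y : completely_monotonic f ->
  0 < z -> z <= y ->
  `|derive1n n f y| * (y - z) ^+ n / n`!%:R <= f z.
Proof.
move=> [sf f0] z0 zy; have y0 := lt_le_trans z0 zy.
have absE k u : 0 < u -> `|derive1n k f u| = (-1) ^+ k * derive1n k f u.
  by move=> u0; rewrite -[RHS]ger0_norm ?f0// normrM normrX normrN1 expr1n mul1r.
have [c] := taylor_cauchy n sf y0 z0.
rewrite (min_idPr zy) (max_idPl zy) => /andP[zc cy] ->.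
have c0 := lt_le_trans z0 zc.
have termE i : derive1n i f y * (z - y) ^+ i / i`!%:R =
    `|derive1n i f y| * (y - z) ^+ i / i`!%:R.
  by rewrite -(opprB y z) [in LHS]exprNn absE//; ring.
have rem0 : 0 <= derive1n n.+1 f c * (z - c) ^+ n / n`!%:R * (z - y).
  have -> : derive1n n.+1 f c * (z - c) ^+ n / n`!%:R * (z - y) =
      `|derive1n n.+1 f c| * (c - z) ^+ n / n`!%:R * (y - z).
    by rewrite -(opprB c z) [in LHS]exprNn absE// exprS; ring.
  by rewrite !mulr_ge0// ?exprn_ge0 ?invr_ge0 ?subr_ge0.
rewrite big_ord_recr/= termE addrAC -[leLHS]add0r lerD// addr_ge0//.
apply: sumr_ge0 => i _; rewrite termE.
by rewrite !mulr_ge0// ?exprn_ge0 ?invr_ge0 ?subr_ge0.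
Qed.

(** This is n s^n <= 1 + s + ... + s^(n-1), multiplied by 1 - s. *)
Lemma natr_mulX_le (s : R) n : 0 <= s -> s <= 1 -> n%:R * s ^+ n * (1 - s) <= 1 - s ^+ n.
Proof.
move=> s0 s1; elim: n => [|n IHn]; first by rewrite !mul0r expr0 subrr.
have sn : s ^+ n.+1 <= 1 by rewrite exprn_ile1.
have := ler_wpM2l s0 IHn.
have : 0 <= (1 - s) * (1 - s ^+ n.+1) by rewrite mulr_ge0 ?subr_ge0.
move: sn; rewrite -natr1 exprS; move: (s ^+ n) (n%:R : R) => t m; nra.
Qed.

(** With t = sqrt s, one factor t^n of s^n absorbs n, since n t^n <= 1 / (1 - t), and the other
    tends to 0. *)
Lemma eq0_of_le_natr_mulX (u M s : R) : 0 <= s -> s < 1 ->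
  (forall n, `|u| <= n.+1%:R * s ^+ n.+1 * M) -> u = 0.
Proof.
move=> s0 s1 uM.
pose t := Num.sqrt s.
have t0 : 0 <= t := sqrtr_ge0 s.
have t2 : s = t ^+ 2 by rewrite sqr_sqrtr.
have t1 : t < 1 by rewrite -sqrtr1 ltr_sqrt.
have bound n : `|u| <= t ^+ n.+1 * (`|M| / (1 - t)).
  apply: (le_trans (uM n)).
  rewrite t2 -exprM mulnC muln2 -addnn exprD !mulrA.
  have : n.+1%:R * t ^+ n.+1 <= (1 - t)^-1.
    rewrite -[leRHS]mul1r ler_pdivlMr ?subr_gt0//.
    rewrite (le_trans (natr_mulX_le n.+1 t0 (ltW t1)))//.
    by rewrite lerBlDr lerDl exprn_ge0.
  move=> h; apply: (@le_trans _ _ (t ^+ n.+1 * (`|M| * (n.+1%:R * t ^+ n.+1)))).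
    have -> : t ^+ n.+1 * (`|M| * (n.+1%:R * t ^+ n.+1)) =
      n.+1%:R * t ^+ n.+1 * t ^+ n.+1 * `|M| by ring.
    by rewrite ler_wpM2l ?ler_norm// !mulr_ge0// exprn_ge0.
  have tn0 : 0 <= t ^+ n.+1 by exact: exprn_ge0.
  rewrite -[leRHS]mulrA; exact: (ler_wpM2l tn0 (ler_wpM2l (normr_ge0 M) h)).
apply/eqP; rewrite -normr_le0.
have : (t ^+ n.+1 * (`|M| / (1 - t))) @[n --> \oo] --> (0 : R).
  rewrite -[X in _ --> X](mul0r (`|M| / (1 - t))).
  apply: cvgMr_tmp; rewrite (@cvg_shiftS _ (fun n => t ^+ n)).
  by apply: cvg_expr; rewrite ger0_norm.
move=> h; rewrite -(cvg_lim _ h)//; apply: limr_ge; first exact: (cvgP _ h).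
by near=> n; exact: bound.
Unshelve. all: by end_near. Qed.

(** All Taylor coefficients of f - g at a vanish, so only the Cauchy remainder is left. The ratio
    condition gives |x - a| < min a x, hence room for a radius r between the two: derivatives at c
    are bounded by (N+1)! / r^(N+1) times a constant, and |x - a| / r < 1 drives the remainder to
    0. *)
Lemma completely_monotonic_eq_near f g a x :
  completely_monotonic f -> completely_monotonic g ->
  0 < a -> 0 < x -> a < 2 * x -> x < 2 * a ->
  (forall n, derive1n n f a = derive1n n g a) -> f x = g x.
Proof.
move=> cmf cmg a0 x0 ax xa fga; apply/eqP; rewrite -subr_eq0; apply/eqP.
have [sf _] := cmf; have [sg _] := cmg.
have [sNg Ng] := smoothZ (-1) sg.
have [sh hE] := smoothD sf sNg.
set h := f \+ _ in sh hE.
have -> : f x - g x = h x by rewrite /h/= mulN1r.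
set y := Num.min a x.
have y0 : 0 < y by rewrite lt_min a0.
have dy : `|x - a| < y.
  by rewrite lt_min !ltr_norml; apply/andP; split; lra.
pose r := (`|x - a| + y) / 2.
have dr : `|x - a| < r by rewrite /r; lra.
have r0 : 0 < r by exact: le_lt_trans dr.
have ry : r < y by rewrite /r; lra.
apply: (@eq0_of_le_natr_mulX _ (f (y - r) + g (y - r)) (`|x - a| / r)).
- by rewrite divr_ge0// ltW.
- by rewrite ltr_pdivrMr// mul1r.
move=> N.
have [c /andP[yc cy] ->] := taylor_cauchy N sh a0 x0.
rewrite big1 ?add0r; last first.
  by move=> i _; rewrite hE// Ng// fga mulN1r subrr !mul0r.
have yr0 : 0 < y - r by rewrite subr_gt0.
have ycr : y - r <= c - r by rewrite lerD2r.
have bound u : completely_monotonic u ->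
    `|derive1n N.+1 u c| <= N.+1`!%:R / r ^+ N.+1 * u (y - r).
  move=> cmu.
  have cr0 : 0 < c - r by exact: lt_le_trans ycr.
  have crc : c - r <= c by rewrite gerBl ltW.
  have := completely_monotonic_derive1n_le N.+1 cmu cr0 crc.
  have -> : c - (c - r) = r by ring.
  (* The derivative bound of order 0 says that u is nonincreasing. *)
  have ucy : u (c - r) <= u (y - r).
    have [_ /(_ 0 (c - r) cr0)] := cmu; rewrite expr0 mul1r/= => uc0.
    have := completely_monotonic_derive1n_le 0 cmu yr0 ycr.
    by rewrite expr0 mulr1 fact0 divr1/= ger0_norm.
  move=> /le_trans/(_ ucy).
  rewrite ler_pdivrMr ?ltr0n ?fact_gt0// -ler_pdivlMr ?exprn_gt0// => /le_trans; apply.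
  by rewrite [leRHS]mulrC mulrA.
have hc : `|derive1n N.+1 h c| <=
    N.+1`!%:R / r ^+ N.+1 * (f (y - r) + g (y - r)).
  have c0 : 0 < c := lt_le_trans y0 yc.
  rewrite hE// Ng// mulN1r mulrDr (le_trans (ler_normB _ _))//.
  by rewrite lerD// bound.
have xc : `|x - c| <= `|x - a|.
  move: yc cy; rewrite /y; have [ax'|xa'] := leP a x => yc cy.
    by rewrite !ger0_norm; lra.
  by rewrite !ler0_norm; lra.
rewrite !normrM normrX.
have -> : `|N`!%:R^-1| = N`!%:R^-1 :> R by rewrite ger0_norm// invr_ge0.
have -> : N.+1%:R * (`|x - a| / r) ^+ N.+1 * (f (y - r) + g (y - r)) =
  (N.+1`!%:R / r ^+ N.+1 * (f (y - r) + g (y - r))) *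
  `|x - a| ^+ N / N`!%:R * `|x - a|.
  rewrite factS natrM expr_div_n !exprS.
  have : (N`!%:R : R) != 0 by rewrite pnatr_eq0 -lt0n fact_gt0.
  have : r ^+ N != 0 by rewrite expf_neq0// gt_eqF.
  have : r != 0 by rewrite gt_eqF.
  by move=> r1 r2 r3; field; rewrite r1 r2 r3.
rewrite ler_wpM2r// ler_wpM2r ?invr_ge0//.
by apply: ler_pM; rewrite ?exprn_ge0// lerXn2r// ?nnegrE.
Qed.

Lemma completely_monotonic_eq f g :
  completely_monotonic f -> completely_monotonic g ->
  (forall n, derive1n n f 1 = derive1n n g 1) ->
  forall x, 0 < x -> f x = g x.
Proof.
move=> cmf cmg fg1 x x0.
(* Equality of values alone would not allow a further step. The local result is applied to every
   (-1)^n f^(n), again completely monotonic, and so transports all derivatives. *)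
have step a b : 0 < a -> 0 < b -> a < 2 * b -> b < 2 * a ->
    (forall n, derive1n n f a = derive1n n g a) ->
    forall n, derive1n n f b = derive1n n g b.
  move=> a0 b0 ab ba fga n.
  apply: (@mulfI _ ((-1) ^+ n)); first by rewrite signr_eq0.
  apply: (completely_monotonic_eq_near (completely_monotonic_derive1n n cmf)
    (completely_monotonic_derive1n n cmg) a0 b0 ab ba) => m.
  have [sf _] := cmf; have [sg _] := cmg.
  have [_ ->//] := smoothZ ((-1) ^+ n) (smooth_derive1n n sf).
  have [_ ->//] := smoothZ ((-1) ^+ n) (smooth_derive1n n sg).
  by congr (_ * _); have := fga (m + n)%N; rewrite /derive1n !iterD.
have l2 : 0 < ln (2 : R) by rewrite ln_gt0// ltr1n.
(* N is large enough for the N-th root r of x to lie strictly between 1/2 and 2. *)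
pose N := (Num.truncn (`|ln x| / ln 2)).+1.
have N0 : (0 : R) < N%:R by rewrite ltr0n.
have lN : `|ln x| / N%:R < ln 2.
  rewrite ltr_pdivrMr// mulrC -ltr_pdivrMr//.
  exact: truncnS_gt.
pose r := expR (ln x / N%:R).
have r0 : 0 < r := expR_gt0 _.
have /andP[r1 r2] : - ln 2 < ln x / N%:R < ln 2.
  by rewrite -ltr_norml normf_div (gtr0_norm N0).
have r_lt2 : r < 2 by rewrite -[ltRHS]lnK ?posrE// ltr_expR.
have r_gt2 : 2^-1 < r by rewrite -[ltLHS]lnK ?posrE ?invr_gt0// ltr_expR lnV ?posrE.
(* Walk from 1 to x along the powers of r, staying within ratio 2. *)
have rk k : forall n, derive1n n f (r ^+ k) = derive1n n g (r ^+ k).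
  elim: k => [|k IHk] //; apply: step IHk; rewrite ?exprn_gt0// exprS.
    rewrite mulrA -[ltLHS]mul1r ltr_pM2r ?exprn_gt0//; lra.
  by rewrite ltr_pM2r ?exprn_gt0.
have := rk N 0; rewrite /= -expRM_natl mulrC divfK ?gt_eqF// lnK//.
Qed.

End completely_monotonic_theory.

(** * The Hausdorff moment problem *)

Lemma sum_ltn_ord N j : (j <= N)%N -> (\sum_(i < N) (i < j) = j)%N.
Proof.
move=> jN; have -> : (\sum_(i < N) (i < j) = minn N j)%N.
  elim: N {jN} => [|N IHN]; first by rewrite big_ord0 min0n.
  by rewrite big_ord_recr/= IHN; case: ltnP => ?; lia.
by rewrite (minn_idPr jN).
Qed.

(** Multiplied by i! (r-i)!, both sides equal (p+r)!. *)
Lemma bin_ffactD p r i : (i <= r)%N ->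
  ('C(p + r, p + i) * (p + i) ^_ p = (p + r) ^_ p * 'C(r, i))%N.
Proof.
move=> ir; apply/eqP; rewrite -(@eqn_pmul2r (i`! * (r - i)`!)%N); last first.
  by rewrite muln_gt0 !fact_gt0.
have E1 := @bin_fact (p + r) (p + i); rewrite leq_add2l subnDl in E1.
have E2 := @ffact_fact (p + i) p (leq_addr _ _); rewrite addKn in E2.
have E3 := @ffact_fact (p + r) p (leq_addr _ _); rewrite addKn in E3.
have E4 := bin_fact ir.
apply/eqP; transitivity ('C(p + r, p + i) * (((p + i) ^_ p * i`!) * (r - i)`!))%N.
  by ring.
by rewrite E2 E1// -E3 -E4; ring.
Qed.

Section hausdorff_moment.
Variable R : realType.
Implicit Types (g q : R -> R) (s x m : R).
Local Notation leb := (@lebesgue_measure R).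

(** A segment is compact, so the image filter has a cluster point, and an ultrafilter converges to
    its cluster points. *)
Lemma ultra_cvg_bounded (T : Type) (F : set_system T) (u : T -> R) (a b : R) :
  UltraFilter F -> (forall t, a <= u t <= b) ->
  exists l : R, u @ F --> l.
Proof.
move=> UF uab; have /(_ (u @ F)) := @segment_compact _ a b.
move=> /(_ _ _)[|l [_ cl]].
  by apply: (@filterS _ F _ setT) => [t _|]; [rewrite /= in_itv/=|exact: filterT].
exists l => B Bl.
have [//|FnB] := in_ultra_setVsetC (u @^-1` B) UF.
have [t []] := cl (~` B) B FnB Bl.
by [].
Qed.

Lemma integrable_itv_co g (a b : R) : {homo g : x y / x <= y} ->
  (forall s, 0 <= g s <= 1) -> leb.-integrable `[a, b[ (EFin \o g).
Proof.
move=> gm g01; apply: measurable_bounded_integrable => //.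
- by rewrite /= lebesgue_measure_itv/=; case: ifP => // _; rewrite -EFinB ltry.
- exact: nondecreasing_measurable.
- exists 1; split=> // M M1 x _/=; have /andP[g0 g1] := g01 x.
  by rewrite ger0_norm// (le_trans g1)// ltW.
Qed.

Lemma Rintegral_cst_itv_co (a b c : R) : a <= b ->
  \int[leb]_(x in `[a, b[) c = c * (b - a).
Proof.
move=> ab; rewrite Rintegral_cst//= lebesgue_measure_itv/= lte_fin.
by case: ltP => ab'; [|rewrite (@le_anti _ _ a b) ?ab// subrr].
Qed.

Lemma Rintegral_itv_co_sum g (S : nat -> R) n : {homo g : x y / x <= y} ->
  (forall s, 0 <= g s <= 1) -> (forall i, S i <= S i.+1) ->
  \int[leb]_(x in `[S 0, S n[) g x =
  \sum_(i < n) \int[leb]_(x in `[S i, S i.+1[) g x.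
Proof.
move=> gm g01 SS.
have S0 k : S 0 <= S k by elim: k => // k /le_trans; apply.
elim: n => [|n IHn].
  by rewrite big_ord0 set_itvco0 Rintegral_set0.
rewrite big_ord_recr/= -IHn.
rewrite (@itv_bndbnd_setU _ _ _ (BLeft (S n))) ?bnd_simp//.
rewrite Rintegral_setU//.
- rewrite -itv_bndbnd_setU ?bnd_simp//; exact: integrable_itv_co.
- apply/disj_setPS => x [/=]; rewrite !in_itv/= => /andP[_ xS] /andP[Sx _].
  by move: xS; rewrite ltNge Sx.
Qed.

(* The error bound is uniform over the monotone functions into [0, 1], which
   lets integrals pass to pointwise limits along an ultrafilter, where dominated
   convergence is not available. *)
Lemma Rintegral_riemann_sum g m M : {homo g : x y / x <= y} ->
  (forall s, 0 <= g s <= 1) -> 0 <= m ->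
  `|\int[leb]_(x in `[0, m[) g x -
    m / M.+1%:R * \sum_(i < M.+1) g (i%:R * (m / M.+1%:R))| <= m / M.+1%:R.
Proof.
move=> gm g01 m0; set d := m / M.+1%:R.
have d0 : 0 <= d by rewrite divr_ge0.
pose S i : R := i%:R * d.
have SS i : S i <= S i.+1 by rewrite ler_wpM2r// ler_nat.
have Sd i : S i.+1 - S i = d by rewrite /S -natr1; ring.
have -> : `[0, m[%classic = `[S 0, S M.+1[%classic.
  by rewrite /S mul0r mulrC divfK.
rewrite Rintegral_itv_co_sum// mulr_sumr -sumrB.
(* On each piece g lies between its endpoint values; the resulting upper bounds telescope to d times
   the total increase of g, which is at most 1. *)
have bound i : 0 <= \int[leb]_(x in `[S i, S i.+1[) g x - d * g (S i) <=
    d * g (S i.+1) - d * g (S i).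
  rewrite subr_ge0 lerD2r.
  have cstE c : d * c = \int[leb]_(x in `[S i, S i.+1[) c.
    by rewrite Rintegral_cst_itv_co// Sd mulrC.
  have icst c : leb.-integrable `[S i, S i.+1[ (EFin \o cst c).
    apply: measurable_bounded_integrable => //; last exact: bounded_cst.
    by rewrite /= lebesgue_measure_itv/=; case: ifP => // _; rewrite -EFinB ltry.
  rewrite !cstE; apply/andP; split; apply: le_Rintegral => //.
  - exact: icst.
  - exact: integrable_itv_co.
  - by move=> x; rewrite /= in_itv/= => /andP[? _]; exact: gm.
  - exact: integrable_itv_co.
  - exact: icst.
  - by move=> x; rewrite /= in_itv/= => /andP[_ /ltW ?]; exact: gm.
rewrite ger0_norm; last first.
  by apply: sumr_ge0 => i _; have /andP[] := bound i.
apply: (@le_trans _ _ (\sum_(i < M.+1) (d * g (S i.+1) - d * g (S i)))).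
  by apply: ler_sum => i _; have /andP[] := bound i.
rewrite -(big_mkord predT (fun i => d * g (S i.+1) - d * g (S i))).
rewrite telescope_sumr// -mulrBr -[leRHS]mulr1 ler_wpM2l//.
have /andP[_ g1] := g01 (S M.+1); have /andP[g0 _] := g01 (S 0).
lra.
Qed.

(* The quantile function (generalized inverse of the distribution function) of
   the measure with mass [w j] at [j / N], for j = 0, ..., N. *)
Definition step_quantile (w : nat -> R) (N : nat) (s : R) : R :=
  (\sum_(j < N) (\sum_(i < j.+1) w i <= s)%R%:R) / N%:R.

Lemma step_quantile_itv (w : nat -> R) N s :
  0 <= step_quantile w N s <= 1.
Proof.
rewrite /step_quantile; case: N => [|N]; first by rewrite big_ord0 mul0r lexx ler01.
apply/andP; split; first by rewrite divr_ge0// sumr_ge0.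
rewrite ler_pdivrMr ?ltr0n// mul1r -[X in _ <= X%:R]card_ord -sumr_const.
by apply: ler_sum => i _; case: (_ <= s).
Qed.

Lemma step_quantile_homo (w : nat -> R) N : {homo step_quantile w N : x y / x <= y}.
Proof.
move=> x y xy; rewrite ler_wpM2r ?invr_ge0//; apply: ler_sum => i _.
rewrite ler_nat; case: (leP (\sum_(_ < _) _) x) => // ix.
by rewrite (le_trans ix xy).
Qed.

(** The interval is cut at the partial sums of [w]: the j-th piece has length [w j], and on it
    exactly j of the compared partial sums are at most s, so the quantile is j / N there. *)
Lemma Rintegral_step_quantile (w : nat -> R) N p : (forall j, 0 <= w j) ->
  \int[leb]_(s in `[0, \sum_(j < N.+1) w j[) step_quantile w N s ^+ p =
  \sum_(j < N.+1) w j * (j%:R / N%:R) ^+ p.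
Proof.
move=> w0; pose S i := \sum_(j < i) w j.
have SS i : S i <= S i.+1 by rewrite /S big_ord_recr/= lerDl.
have S_le : {homo S : i j / (i <= j)%N >-> i <= j}.
  by apply: homo_leq => // ? ? ?; exact: le_trans.
have -> : `[0, \sum_(j < N.+1) w j[%classic = `[S 0, S N.+1[%classic.
  by rewrite /S big_ord0.
rewrite Rintegral_itv_co_sum//; last 2 first.
- move=> x y xy; rewrite lerXn2r// ?nnegrE ?step_quantile_homo//.
    by have /andP[] := step_quantile_itv w N x.
  by have /andP[] := step_quantile_itv w N y.
- move=> s; have /andP[q0 q1] := step_quantile_itv w N s.
  by rewrite exprn_ge0// exprn_ile1.
apply: eq_bigr => -[j jN] _ /=; rewrite -ltnS in jN.
transitivity (\int[leb]_(s in `[S j, S j.+1[) (j%:R / N%:R) ^+ p).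
  apply: eq_Rintegral => s; rewrite inE/= in_itv/= => /andP[Sjs sSj].
  congr (_ ^+ _); congr (_ / _).
  rewrite (eq_bigr (fun i : 'I_N => (i < j)%N%:R)); last first.
    move=> i _; congr (nat_of_bool _)%:R; case: ltnP => ij.
      by rewrite (le_trans _ Sjs)//; exact: S_le.
    apply/negbTE; rewrite -ltNge (lt_le_trans sSj)//; exact: S_le.
  by rewrite -natr_sum sum_ltn_ord.
by rewrite Rintegral_cst_itv_co// /S big_ord_recr/= addrAC subrr add0r mulrC.
Qed.

(** The left ratio is a product of factors (j-i)/(N-i), each within i/N of j/N. Everything lies in
    [0, 1], so the errors add up; p^2 is a convenient bound for their sum. *)
Lemma ffact_ratio_near (N j p : nat) : (p <= N)%N -> (0 < N)%N -> (j <= N)%N ->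
  `|(j ^_ p)%:R / (N ^_ p)%:R - (j%:R / N%:R) ^+ p| <= (p ^ 2)%:R / N%:R :> R.
Proof.
move=> + N0 jN; elim: p => [|p IHp] pN.
  by rewrite !ffactn0 expr0 divr1 subrr normr0 divr_ge0.
have {}IHp := IHp (ltnW pN).
rewrite !ffactnSr !natrM invfM exprSr.
set a := (j ^_ p)%:R / (N ^_ p)%:R in IHp *; set c := (j%:R / N%:R : R) in IHp *.
rewrite [X in X - _](_ : _ = a * ((j - p)%:R / (N - p)%:R)); last by rewrite /a; ring.
set b := (j - p)%:R / (N - p)%:R.
have N0' : (0 : R) < N%:R by rewrite ltr0n.
have Np : (0 : R) < (N - p)%:R by rewrite ltr0n subn_gt0.
have c01 : 0 <= c <= 1 by rewrite divr_ge0//= ler_pdivrMr// mul1r ler_nat.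
have b01 : 0 <= b <= 1.
  by rewrite divr_ge0//= ler_pdivrMr// mul1r ler_nat leq_sub2r.
have bc : `|b - c| <= p%:R / N%:R.
  rewrite /b /c; case: (leqP p j) => pj.
    have -> : (j - p)%:R / (N - p)%:R - j%:R / N%:R =
        - (p%:R / N%:R * ((N - j)%:R / (N - p)%:R)) :> R.
      move: Np; rewrite !natrB// 1?ltnW// => Np.
      by field; rewrite !gt_eqF.
    rewrite normrN ger0_norm ?mulr_ge0// ler_piMr ?divr_ge0//.
    by rewrite ler_pdivrMr// mul1r ler_nat leq_sub2l.
  (* Here [j - p] is truncated to 0, and j / N <= p / N is enough. *)
  rewrite (eqP (ltnW pj : _ - _ == 0)%N) mul0r sub0r normrN ger0_norm ?divr_ge0//.
  by rewrite ler_pM2r ?invr_gt0// ler_nat ltnW.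
clearbody a b c.
have -> : a * b - c ^+ p * c = (a - c ^+ p) * b + c ^+ p * (b - c) by ring.
move: b01 c01 => /andP[b0 b1] /andP[c0 c1].
rewrite (le_trans (ler_normD _ _))// !normrM (ger0_norm b0).
rewrite (ger0_norm (exprn_ge0 _ c0)).
apply: (@le_trans _ _ ((p ^ 2)%:R / N%:R + p%:R / N%:R)); last first.
  have pp : (p ^ 2)%:R + p%:R <= p.+1%:R * p.+1%:R :> R.
    by rewrite -natrD -natrM ler_nat; nia.
  by rewrite -mulrDl ler_pM2r ?invr_gt0.
apply: lerD.
  by rewrite (le_trans _ IHp)// ler_piMr.
by rewrite (le_trans _ bc)// ler_piMl// exprn_ile1.
Qed.

Section pascal_harmonic.
Variable h : nat -> nat -> R.
Hypothesis h_ge0 : forall n k, 0 <= h n k.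
Hypothesis hS : forall n k, h n k = h n.+1 k + h n k.+1.

(** Iterating [hS] r times follows the paths of Pascal's triangle; 'C(r, i) of them raise the first
    index i times. *)
Lemma harmonic_expand r p k :
  h p k = \sum_(i < r.+1) 'C(r, i)%:R * h (p + i)%N (k + (r - i))%N.
Proof.
elim: r p k => [|r IHr] p k.
  by rewrite big_ord1 bin0 mul1r !addn0.
rewrite hS (IHr p.+1) (IHr p k.+1).
rewrite [in RHS]big_ord_recl/= [X in _ + X](_ : _ =
  \sum_(i < r.+2) 'C(r, i)%:R * h (p + i)%N (k + (r.+1 - i))%N); last first.
  rewrite [RHS]big_ord_recr/= bin_small// mul0r addr0.
  by apply: eq_bigr => -[i ir] _ /=; congr (_ * h _ _); lia.
rewrite [X in _ + X]big_ord_recl/= addrCA !bin0; congr (_ + _).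
rewrite -big_split/=; apply: eq_bigr => i _.
rewrite /bump/= add1n binS natrD mulrDl addrC; congr (_ + _).
by congr (_ * h _ _); lia.
Qed.

Let w N j := 'C(N, j)%:R * h j (N - j).

(** [h p 0] is a normalized factorial moment of the masses [w N]: after expansion to level N,
    [bin_ffactD] trades 'C(N - p, i) for 'C(N, p + i), and the terms with j < p vanish with their
    falling factorial. *)
Lemma harmonic_moment N p : (p <= N)%N ->
  h p 0 = \sum_(j < N.+1) w N j * ((j ^_ p)%:R / (N ^_ p)%:R).
Proof.
move=> pN; rewrite (harmonic_expand (N - p) p 0).
rewrite -(big_mkord predT (fun j => w N j * ((j ^_ p)%:R / (N ^_ p)%:R))).
rewrite (@big_cat_nat _ _ _ p)/= ?(leqW pN)//.
rewrite [X in _ = X + _]big_nat_cond [X in _ = X + _]big1 ?add0r; last first.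
  move=> i; rewrite andbT => /= ip.
  by rewrite ffact_small// mul0r mulr0.
have -> : index_iota p N.+1 = index_iota (0 + p) N.+1 by rewrite add0n.
rewrite big_addn subSn// big_mkord.
apply: eq_bigr => -[i /= ir] _; rewrite ltnS in ir.
have := bin_ffactD p ir; rewrite subnKC// => E.
have N0 : ((N ^_ p)%:R : R) != 0 by rewrite pnatr_eq0 -lt0n ffact_gt0.
have Ni : (N - (p + i) = N - p - i)%N by lia.
rewrite /w add0n (addnC i) Ni [RHS]mulrAC; congr (_ * _).
by rewrite mulrA -natrM E natrM mulrAC mulfV// mul1r.
Qed.

(* [q] is an ultrafilter limit of the quantile functions of the measures with
   mass C(N, j) * h j (N - j) at j / N. *)
Lemma hausdorff_moment : exists q : R -> R,
  [/\ {homo q : x y / x <= y}, forall s, 0 <= q s <= 1 &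
   forall p, \int[leb]_(s in `[0, h 0 0[) q s ^+ p = h p 0].
Proof.
have [U [UU ooU]] := @ultraFilterLemma nat \oo _.
pose qN N := step_quantile (w N) N.
have /choice[q qNq] s : exists l : R, qN ^~ s @ U --> l.
  by apply: (@ultra_cvg_bounded _ _ _ 0 1) => N; exact: step_quantile_itv.
have q01 s : 0 <= q s <= 1.
  apply/andP; split.
    apply: (cvgr_to_ge (qNq s)); apply: nearW => N.
    by have /andP[] := step_quantile_itv (w N) N s.
  apply: (cvgr_to_le (qNq s)); apply: nearW => N.
  by have /andP[] := step_quantile_itv (w N) N s.
have qm : {homo q : x y / x <= y}.
  move=> x y xy; apply: (ler_cvg_to (qNq x) (qNq y)).
  by apply: nearW => N; exact: step_quantile_homo.
exists q; split => // p.
set m := h 0 0.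
have m0 : 0 <= m by exact: h_ge0.
have powm g : {homo g : x y / x <= y} -> (forall s, 0 <= g s <= 1) ->
    {homo (fun s => g s ^+ p) : x y / x <= y} /\ forall s, 0 <= g s ^+ p <= 1.
  move=> gm g01; split=> [x y xy|s].
    have /andP[gx _] := g01 x; have /andP[gy _] := g01 y.
    by rewrite lerXn2r// ?nnegrE// gm.
  have /andP[gs gs1] := g01 s.
  by rewrite exprn_ge0// exprn_ile1.
have w_ge0 N j : 0 <= w N j by rewrite mulr_ge0.
have wm N : \sum_(j < N.+1) w N j = m.
  rewrite /m (@harmonic_moment N 0)//; apply: eq_bigr => j _.
  by rewrite !ffactn0 divr1 mulr1.
have step N : (p <= N)%N -> (0 < N)%N ->
    `|\int[leb]_(s in `[0, m[) qN N s ^+ p - h p 0| <= m * ((p ^ 2)%:R / N%:R).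
  move=> pN N0; rewrite -(wm N) Rintegral_step_quantile//.
  rewrite (harmonic_moment pN) -sumrB mulr_suml.
  rewrite (le_trans (ler_norm_sum _ _ _))//; apply: ler_sum => -[j jN] _ /=.
  rewrite -mulrBr normrM ger0_norm// ler_wpM2l// distrC.
  by apply: ffact_ratio_near.
pose RS g M : R := m / M.+1%:R * \sum_(i < M.+1) g (i%:R * (m / M.+1%:R)) ^+ p.
have RSE g M : {homo g : x y / x <= y} -> (forall s, 0 <= g s <= 1) ->
    `|\int[leb]_(s in `[0, m[) g s ^+ p - RS g M| <= m / M.+1%:R.
  by move=> gm g01; have [gm' g01'] := powm g gm g01; exact: Rintegral_riemann_sum.
have RScvg M : RS (qN N) M @[N --> U] --> RS q M.
  apply: cvgMl_tmp; apply: cvg_big => [|i _].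
    exact: add_continuous.
  exact: (continuous_cvg _ (@exprn_continuous R p _) (qNq _)).
have near_large (e : R) : 0 < e ->
    \forall N \near U, m * ((p ^ 2)%:R / N%:R) <= e /\ (p <= N)%N /\ (0 < N)%N.
  move=> e0; apply: ooU.
  exists (p + (Num.truncn (e^-1 * (m * (p ^ 2)%:R))).+1)%N => // N /= pN.
  split; last by split; lia.
  have N0 : (0 : R) < N%:R by rewrite ltr0n; lia.
  rewrite mulrA ler_pdivrMr// -ler_pdivrMl// ltW//.
  apply: (lt_le_trans (truncnS_gt _)); rewrite ler_nat.
  exact: leq_trans (leq_addl _ _) pN.
apply/eqP; rewrite -subr_eq0 -normr_le0; apply/ler_addgt0Pl => e e0.
rewrite addr0.
(* Three errors of e / 4 occur: the Riemann sum of q, the Riemann sum of [qN N], and the moment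
   error of [qN N]. The last two are combined at finite N and then passed to the limit along [U]
   with M fixed. *)
pose M := Num.truncn (m * 4 / e).
have dM : m / M.+1%:R <= e / 4.
  rewrite ler_pdivrMr//; have := truncnS_gt (m * 4 / e).
  by rewrite ltr_pdivrMr// -/M; move: (M.+1%:R : R) => t; lra.
have RSh : `|RS q M - h p 0| <= e / 4 + e / 4.
  have cvgRS : `|RS (qN N) M - h p 0| @[N --> U] --> `|RS q M - h p 0|.
    by apply: cvg_norm; apply: cvgB; [exact: RScvg|exact: cvg_cst].
  apply: (cvgr_to_le cvgRS); near=> N.
  have [Ne [pN N0]] : m * ((p ^ 2)%:R / N%:R) <= e / 4 /\ (p <= N)%N /\ (0 < N)%N.
    by near: N; apply: near_large; rewrite divr_gt0.
  have h1 := le_trans (step N pN N0) Ne.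
  have := RSE (qN N) M (@step_quantile_homo _ _) (@step_quantile_itv _ _).
  rewrite distrC => /le_trans/(_ dM) h2.
  apply: (le_trans (ler_distD (\int[leb]_(s in `[0, m[) qN N s ^+ p) _ _)).
  exact: lerD.
apply: (le_trans (ler_distD (RS q M) _ _)).
apply: (le_trans (lerD (le_trans (RSE q M qm q01) dM) RSh)).
by move: (e : R) e0 => t t0; lra.
Unshelve. all: by end_near. Qed.

End pascal_harmonic.
End hausdorff_moment.

(** * Measures with density *)

Section density.
Local Open Scope ereal_scope.
Context d (T : measurableType d) (R : realType).
Variables (mu : {measure set T -> \bar R}) (f : T -> R).
Hypotheses (mf : measurable_fun setT f) (f0 : forall x, (0 <= f x)%R).

(* The proofs are arguments so that the measure instance below can use them. *)
Definition density_measure of measurable_fun setT f & (forall x, (0 <= f x)%R) :=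
  fun A : set T => \int[mu]_(x in A) (f x)%:E.

Local Notation nu := (density_measure mf f0).

Let density0 : nu set0 = 0.
Proof. by rewrite /density_measure integral_set0. Qed.

Let density_ge0 A : 0 <= nu A.
Proof. by apply: integral_ge0 => x _; rewrite lee_fin. Qed.

Let density_sigma_additive : semi_sigma_additive nu.
Proof.
apply: semi_sigma_additive_nng_induced; first exact/measurable_EFinP.
by move=> x; rewrite lee_fin.
Qed.

HB.instance Definition _ := isMeasure.Build _ _ _ nu
  density0 density_ge0 density_sigma_additive.

Import HBNNSimple.

Let integral_density_nnsfun (h : {nnsfun T >-> R}) :
  \int[nu]_x (h x)%:E = \int[mu]_x ((h x)%:E * (f x)%:E).
Proof.
transitivity (\int[nu]_x
    (\sum_(y \in range h) (y * \1_(h @^-1` [set y]) x)%:E)).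
  by apply: eq_integral => t _; rewrite /= fimfunE -fsumEFin.
have mindic r : measurable_fun setT (fun x => (r * \1_(h @^-1` [set r]) x)%:E).
  by apply/measurable_EFinP; apply: measurable_funM.
have mEf : measurable_fun setT (EFin \o f) by exact/measurable_EFinP.
rewrite ge0_integral_fsum//; last by move=> y x _; exact: nnfun_muleindic_ge0.
transitivity (\int[mu]_x (\sum_(y \in range h)
    (y * \1_(h @^-1` [set y]) x)%:E * (f x)%:E)); last first.
  apply: eq_integral => x _.
  rewrite -ge0_mule_fsuml => [|y]; last exact: nnfun_muleindic_ge0.
  by rewrite fsumEFin // -(fimfunE _ x).
rewrite ge0_integral_fsum//; last 2 first.
  - by move=> y; apply: emeasurable_funM.
  - move=> y x _; apply: mule_ge0; last by rewrite lee_fin.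
    exact: nnfun_muleindic_ge0.
apply: eq_fsbigr => r rh.
under eq_integral do rewrite EFinM.
rewrite integralZl_indic_nnsfun => //.
under [RHS]eq_integral do rewrite EFinM -muleA.
rewrite ge0_integralZl//.
- under [X in _ = _ * X]eq_integral do rewrite muleC.
  rewrite [X in _ = _ * X](eq_integral ((EFin \o f) \_ (h @^-1` [set r]))); last first.
    by move=> x xE; rewrite epatch_indic.
  by rewrite -integral_mkcond integral_indic// setIT.
- by apply: emeasurable_funM => //; exact/measurable_EFinP.
- by move=> t _; rewrite mule_ge0 ?lee_fin.
- by move: rh; rewrite inE => -[t _ <-]; rewrite lee_fin.
Qed.

(** Simple functions first, then monotone convergence on both sides. *)
Lemma integral_density (g : T -> \bar R) :
  measurable_fun setT g -> (forall x, 0 <= g x) ->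
  \int[nu]_x g x = \int[mu]_x (g x * (f x)%:E).
Proof.
move=> mg g0; pose h := nnsfun_approx measurableT mg.
have gE x : g x = limn (fun n => (h n x)%:E).
  by apply/esym/cvg_lim => //; exact: cvg_nnsfun_approx.
have gfE x : g x * (f x)%:E = limn (fun n => (h n x)%:E * (f x)%:E).
  apply/esym/cvg_lim => //; apply: cvgeZr => //.
  exact: cvg_nnsfun_approx.
have nd x (a b : nat) : (a <= b)%N -> (h a x)%:E <= (h b x)%:E.
  by move=> ab; rewrite lee_fin; exact/lefP/nd_nnsfun_approx.
transitivity (\int[nu]_x limn (fun n => (h n x)%:E)).
  by apply: eq_integral => x _; exact: gE.
transitivity (\int[mu]_x limn (fun n => (h n x)%:E * (f x)%:E)); last first.
  by apply: eq_integral => x _; rewrite gfE.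
rewrite monotone_convergence//; last 3 first.
- by move=> n; exact/measurable_EFinP.
- by move=> n x _; rewrite lee_fin.
- by move=> x _ a b; exact: nd.
rewrite monotone_convergence//.
- by congr (limn _); apply/funext => n; exact: integral_density_nnsfun.
- by move=> n; apply: emeasurable_funM; exact/measurable_EFinP.
- by move=> n x _; rewrite mule_ge0// lee_fin.
- by move=> x _ a b ab; rewrite lee_wpmul2r ?lee_fin// -lee_fin nd.
Qed.

End density.

Lemma integral_pushforward_density d1 d2 (T1 : measurableType d1)
    (T2 : measurableType d2) (R : realType) (mu : {measure set T1 -> \bar R})
    (phi : T1 -> T2) (f : T1 -> R) :
  measurable_fun setT phi -> measurable_fun setT f -> (forall x, 0 <= f x) ->
  exists nu : {measure set T2 -> \bar R}, forall g : T2 -> \bar R,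
    measurable_fun setT g -> (forall y, 0 <= g y)%E ->
    (\int[nu]_y g y = \int[mu]_x (g (phi x) * (f x)%:E))%E.
Proof.
move=> mphi mf f0.
exists (pushforward (density_measure mu mf f0) phi) => g mg g0.
rewrite ge0_integral_pushforward// integral_density//.
  exact: measurableT_comp.
by move=> x; exact: g0.
Unshelve. exact: mphi. Qed.

Lemma measurable_powRV (R : realType) (a b : R) :
  measurable_fun setT (fun t : R => ((a + t) `^ b)^-1).
Proof.
under eq_fun do rewrite -powRN.
apply: (measurableT_comp (@measurable_powR R (- b))).
exact: measurable_funD.
Qed.

(** * From Hausdorff moments to a measure on the half-line *)

Section moment_measure.
Variable R : realType.
Local Notation leb := (@lebesgue_measure R).

(** Under t = 1/q - 1 one has 1 + t = 1/q, so (1 + t)^(-lam-n) times the density q^(-lam) is q^n.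
    The set where q vanishes corresponds to t at infinity; it contributes only to the moment of
    order 0, through c. *)
Lemma stieltjes_measure_of_moments (lam m : R) (q : R -> R) :
  0 < lam -> {homo q : x y / x <= y} -> (forall s, 0 <= q s <= 1) ->
  exists (mu : {measure set (measurableTypeR R) -> \bar R}) (c : R), 0 <= c /\
  forall n, mu.-integrable `[0, +oo[ (fun t => ((1 + t) `^ (lam + n%:R))^-1%:E) /\
  \int[leb]_(s in `[0, m[) q s ^+ n =
  \int[mu]_(t in `[0, +oo[) ((1 + t) `^ (lam + n%:R))^-1 + (if n is 0 then c else 0).
Proof.
move=> lam0 qm q01.
have mq : measurable_fun setT q by exact: nondecreasing_measurable.
have q_ge0 s : 0 <= q s by have /andP[] := q01 s.
have q_le1 s : q s <= 1 by have /andP[] := q01 s.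
(* Where [q s = 0], [phi s = -1] lies outside [0, +oo[. *)
pose phi s := q s `^ (-1) - 1.
have mphi : measurable_fun setT phi.
  apply: measurable_funB => //.
  exact: (measurableT_comp (@measurable_powR R (-1))).
set E := `[0, m[%classic.
have mE : measurable E by exact: measurable_itv.
(* A nonzero power of 0 is 0 by convention, so this density vanishes where q does. *)
pose f := (fun s => q s `^ (- lam)) \_ E.
have mf : measurable_fun setT f.
  apply/measurable_restrict => //; apply: measurable_funTS.
  exact: (measurableT_comp (@measurable_powR R (- lam))).
have f0 s : 0 <= f s.
  by rewrite /f patchE; case: ifP => // _; exact: powR_ge0.
have [mu muE] := @integral_pushforward_density _ _ _ (measurableTypeR R)
  R leb phi f mphi mf f0.
exists mu.
exists (\int[leb]_(s in E) (q s == 0)%:R); split.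
  by apply: Rintegral_ge0.
move=> n.
set g := fun t => ((1 + t) `^ (lam + n%:R))^-1.
have g0 t : 0 <= g t by rewrite invr_ge0 powR_ge0.
have mg : measurable_fun setT g by exact: measurable_powRV.
have mgE : measurable_fun setT (EFin \o g) by exact/measurable_EFinP.
set D := `[0, +oo[%classic.
have mD : measurable D by exact: measurable_itv.
have intE : (\int[mu]_(t in D) (g t)%:E =
    \int[leb]_(s in E) (q s ^+ n * (q s != 0)%:R)%:E)%E.
  rewrite [LHS]integral_mkcond muE; last 2 first.
  - apply: (iffLR (measurable_restrictT (EFin \o g) _)) => //.
    exact: measurable_funTS mgE.
  - move=> y; rewrite patchE; case: ifP => // _; first by rewrite lee_fin.
  rewrite [RHS]integral_mkcond; apply: eq_integral => s _.
  rewrite /f !patchE; have [sE|sE] := boolP (s \in E); last by rewrite mule0.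
  have [q0|q0] := eqVneq (q s) 0.
    by rewrite q0 powR0 ?oppr_eq0 ?gt_eqF// mule0 mulr0.
  have qs0 : 0 < q s by rewrite lt_neqAle eq_sym q0 q_ge0.
  have phiE : 1 + phi s = (q s)^-1.
    by rewrite /phi powR_inv1// addrC subrK.
  rewrite ifT; last first.
    rewrite inE /D/= in_itv/= andbT /phi powR_inv1// subr_ge0.
    by rewrite invf_ge1.
  rewrite -EFinM /g phiE; congr (_%:E).
  rewrite -[(q s)^-1]powR_inv1// -powRrM -powRN -gt0_powRD// mulr1 -powR_mulrn//.
  by congr (_ `^ _); ring.
have bint (u : R -> R) : measurable_fun setT u -> (forall s, 0 <= u s <= 1) ->
    leb.-integrable E (EFin \o u).
  move=> mu' u01; apply: measurable_bounded_integrable => //.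
  - by rewrite /= lebesgue_measure_itv/=; case: ifP => // _; rewrite -EFinB ltry.
  - exact: measurable_funTS.
  - exists 1; split=> // M M1 x _/=; have /andP[u0 u1] := u01 x.
    by rewrite ger0_norm// (le_trans u1)// ltW.
have mq0 : measurable_fun setT (fun s => (q s == 0)%:R : R).
  rewrite (_ : (fun s => _) = (fun s => if q s == 0 then 1 else 0 : R)).
    by apply: measurable_fun_ifT => //; exact: measurable_fun_eqr.
  by apply/funext => s; case: eqP.
have mqn0 : measurable_fun setT (fun s => (q s != 0)%:R : R).
  rewrite (_ : (fun s => _) = (fun s => 1 - (q s == 0)%:R : R)).
    exact: measurable_funB.
  by apply/funext => s; case: eqP => _ /=; rewrite ?subrr ?subr0.
have i1 : leb.-integrable E (EFin \o (fun s => q s ^+ n * (q s != 0)%:R)).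
  apply: bint => [|s].
    by apply: measurable_funM => //; exact: measurable_funX.
  by case: eqP => _; rewrite ?mulr0 ?mulr1 ?lexx ?ler01// exprn_ge0// exprn_ile1.
have i2 : leb.-integrable E (EFin \o (fun s => (q s == 0)%:R)).
  by apply: bint => // s; case: eqP => _; rewrite ?lexx ?ler01.
split.
  apply/integrableP; split; first exact: measurable_funTS mgE.
  have -> : (\int[mu]_(t in D) `|(g t)%:E| = \int[mu]_(t in D) (g t)%:E)%E.
    by apply: eq_integral => t _; rewrite gee0_abs// lee_fin.
  rewrite intE; exact: integrable_lty i1.
have -> : \int[mu]_(t in D) g t =
    \int[leb]_(s in E) (q s ^+ n * (q s != 0)%:R).
  by rewrite /Rintegral intE.
(* For n > 0 the factor q^n already vanishes where q does; for n = 0 the constant 1 splits into the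
   indicators of q != 0 and q = 0. *)
case: n @g g0 mg mgE intE i1 => [|n] g g0 mg mgE intE i1; last first.
  rewrite addr0; apply: eq_Rintegral => s _.
  by have [->|_] := eqVneq (q s) 0; rewrite ?mulr1// expr0n mul0r.
rewrite -RintegralD//; apply: eq_Rintegral => s _.
by rewrite expr0 mul1r; case: eqP => _ /=; rewrite ?add0r ?addr0.
Qed.

End moment_measure.

(** * Stieltjes integrals *)

Lemma powRN_le (R : realType) (x y r : R) : 0 < x -> x <= y -> 0 <= r ->
  y `^ (- r) <= x `^ (- r).
Proof.
move=> x0 xy r0; have y0 := lt_le_trans x0 xy.
rewrite !powRN lef_pV2 ?posrE ?powR_gt0//.
by rewrite ge0_ler_powR// nnegrE ltW.
Qed.

Lemma is_derive_powR_shift (R : realType) (t a x : R) : 0 < x + t ->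
  is_derive x 1 (fun x => (x + t) `^ a) (a * (x + t) `^ (a - 1)).
Proof.
move=> xt; have dp := is_derive1_powR a xt.
have ds : is_derive x (1 : R) (fun x => x + t) 1.
  have := is_deriveD (is_derive_id x (1 : R)) (is_derive_cst t x (1 : R)).
  by rewrite addr0.
have := @is_derive1_comp _ (fun y => y `^ a) (fun x => x + t) x _ _ dp ds.
by rewrite mulr1.
Qed.

Section stieltjes_integral.
Variable R : realType.
Variable mu : {measure set (measurableTypeR R) -> \bar R}.
Variable lam : R.
Hypothesis lam0 : 0 < lam.
Hypothesis int_lam : forall x : R, 0 < x ->
  mu.-integrable `[0, +oo[ (fun t => ((x + t) `^ lam)^-1%:E).

(** Two indices make the family stable: differentiation in x raises a, and c_k f corresponds to the
    indices k and lam + k. *)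
Definition stieltjes_integral (k : nat) (a x : R) : R :=
  \int[mu]_(t in `[0, +oo[) (t ^+ k * (x + t) `^ (- a)).

Let mD : measurable (`[0, +oo[%classic : set (measurableTypeR R)).
Proof. exact: measurable_itv. Qed.

(** Since t^k <= (x+t)^k, the integrand is at most (x+t)^(k-a), which is bounded by x^(-(a-k-lam))
    (x+t)^(-lam). *)
Lemma integrable_stieltjes k (a x : R) : lam + k%:R <= a -> 0 < x ->
  mu.-integrable `[0, +oo[ (fun t => (t ^+ k * (x + t) `^ (- a))%:E).
Proof.
move=> ka x0.
have := integrableZl mD (x `^ (- (a - k%:R - lam))) (int_lam x0).
apply: le_integrable => //.
  apply/measurable_EFinP; apply: measurable_funTS; apply: measurable_funM.
    exact: measurable_funX.
  apply: (measurableT_comp (@measurable_powR R (- a))).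
  exact: measurable_funD.
move=> t; rewrite /= in_itv/= andbT => t0; rewrite lee_fin.
have xt : 0 < x + t by rewrite ltr_wpDr.
rewrite !ger0_norm ?mulr_ge0 ?exprn_ge0 ?invr_ge0 ?powR_ge0//.
rewrite -powRN; apply: (@le_trans _ _ ((x + t) ^+ k * (x + t) `^ (- a))).
  by rewrite ler_wpM2r ?powR_ge0// lerXn2r ?nnegrE ?(ltW xt)// lerDr ltW.
have -> : (x + t) ^+ k * (x + t) `^ (- a) =
    (x + t) `^ (- (a - k%:R - lam)) * (x + t) `^ (- lam).
  rewrite -powR_mulrn ?(ltW xt)// -!gt0_powRD//; congr (_ `^ _); ring.
rewrite ler_wpM2r ?powR_ge0//; apply: powRN_le => //; first by rewrite lerDl.
by rewrite -addrA -opprD subr_ge0 addrC.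
Qed.

Lemma is_derive_stieltjes k (a x : R) : lam + k%:R <= a -> 0 < x ->
  is_derive x 1 (stieltjes_integral k a) (- a * stieltjes_integral k (a + 1) x).
Proof.
move=> ka x0.
have a0 : 0 < a by rewrite (lt_le_trans _ ka)// ltr_wpDr.
have x20 : 0 < x / 2 by rewrite divr_gt0.
pose f (y t : R) := t ^+ k * (y + t) `^ (- a).
(* [G] dominates the y-derivative for all y > x / 2 and t >= 0; the absolute value keeps it
   nonnegative for negative t too. *)
pose G (t : R) := a * (`|t| ^+ k * (x / 2 + t) `^ (- (a + 1))).
have ka1 : lam + k%:R <= a + 1 by rewrite (le_trans ka)// lerDl.
have Ix : `](x / 2), (2 * x)[%classic x by rewrite /= in_itv/=; lra.
have df (y t : R) : 0 < y -> 0 <= t ->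
    is_derive y 1 (f ^~ t) (- a * (t ^+ k * (y + t) `^ (- (a + 1)))).
  move=> y0 t0; have yt : 0 < y + t by rewrite ltr_wpDr.
  have := is_deriveZ (t ^+ k) (is_derive_powR_shift (- a) yt).
  by move=> /is_derive_eq; apply; rewrite /GRing.scale/= opprD; ring.
have intf (y : R) : `](x / 2), (2 * x)[%classic y -> mu.-integrable `[0, +oo[ (EFin \o f y).
  rewrite /= in_itv/= => /andP[y0 _]; apply: integrable_stieltjes => //.
  exact: lt_trans y0.
have derf (y t : R) : `](x / 2), (2 * x)[%classic y -> `[0, +oo[%classic t ->
    derivable (f ^~ t) y 1.
  rewrite /= !in_itv/= andbT => /andP[y0 _] t0.
  by have [] := df y t (lt_trans x20 y0) t0.
have G0 (t : R) : 0 <= G t by rewrite !mulr_ge0 ?exprn_ge0 ?powR_ge0// ltW.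
have intG : mu.-integrable `[0, +oo[ (EFin \o G).
  have := integrableZl mD a (integrable_stieltjes ka1 x20).
  apply: eq_integrable => // t; rewrite inE/= in_itv/= andbT => t0.
  by rewrite /G/= ger0_norm// EFinM.
have Gub (y t : R) : `](x / 2), (2 * x)[%classic y -> `[0, +oo[%classic t ->
    `|partial1of2 f y t| <= G t.
  rewrite /= !in_itv/= andbT => /andP[y0 _] t0.
  have [_ dE] := df y t (lt_trans x20 y0) t0.
  rewrite partial1of2E dE !normrM normrN (gtr0_norm a0) normrX.
  rewrite ler_wpM2l ?(ltW a0)// ler_wpM2l ?exprn_ge0// ger0_norm ?powR_ge0//.
  apply: powRN_le; [by rewrite ltr_wpDr|by rewrite lerD2r ltW|].
  by rewrite addr_ge0// ltW.
split.
  exact: (@derivable_under_integral _ _ _ mu f _ mD x _ _ Ix intf derf G G0 intG Gub).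
rewrite -derive1E.
rewrite (@differentiation_under_integral _ _ _ mu f _ mD x _ _ Ix intf derf G G0 intG Gub).
rewrite /stieltjes_integral -RintegralZl//; last exact: integrable_stieltjes.
apply: eq_Rintegral => t; rewrite inE/= in_itv/= andbT => t0.
by have [_ dE] := df x t x0 t0; rewrite partial1of2E dE.
Qed.

Lemma derive1n_stieltjes k (a : R) : lam + k%:R <= a ->
  smooth_on_pos (stieltjes_integral k a) /\
  forall (n : nat) (x : R), 0 < x -> derive1n n (stieltjes_integral k a) x =
    (-1) ^+ n * (\prod_(i < n) (a + i%:R)) * stieltjes_integral k (a + n%:R) x.
Proof.
move=> ka.
pose F n (x : R) := (-1) ^+ n * (\prod_(i < n) (a + i%:R)) *
  stieltjes_integral k (a + n%:R) x.
have FE0 (x : R) : F 0 x = stieltjes_integral k a x.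
  by rewrite /F big_ord0 addr0 expr0 !mul1r.
have [|sF dF] := @is_derive_tower _ F.
  move=> n x x0; rewrite /F.
  have kan : lam + k%:R <= a + n%:R by rewrite (le_trans ka)// lerDl.
  have := is_deriveZ ((-1) ^+ n * (\prod_(i < n) (a + i%:R)))
    (is_derive_stieltjes kan x0).
  move=> /is_derive_eq; apply; rewrite /GRing.scale/= big_ord_recr/= exprS.
  by rewrite -addrA natr1; ring.
split=> [|n x x0]; first by apply: eq_pos_smooth sF => x _.
by rewrite -[RHS]/(F n x) -dF//; apply: eq_pos_derive1n.
Qed.

Lemma stieltjes_integral_ge0 k a x : 0 <= x -> 0 <= stieltjes_integral k a x.
Proof.
move=> x0; apply: Rintegral_ge0 => t; rewrite /= in_itv/= andbT => t0.
by rewrite mulr_ge0 ?exprn_ge0 ?powR_ge0.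
Qed.

(** Write one factor t as (x + t) - x. *)
Lemma stieltjes_integralS k (a x : R) : lam + k%:R <= a -> 0 < x ->
  stieltjes_integral k.+1 (a + 1) x =
  stieltjes_integral k a x - x * stieltjes_integral k (a + 1) x.
Proof.
move=> ka x0.
have ka1 : lam + k%:R <= a + 1 by rewrite (le_trans ka)// lerDl.
have i1 := integrable_stieltjes ka x0.
have i2 := integrable_stieltjes ka1 x0.
rewrite /stieltjes_integral -RintegralZl//.
rewrite -RintegralB//; last first.
  by have := integrableZl mD x i2; apply: eq_integrable.
apply: eq_Rintegral => t; rewrite inE/= in_itv/= andbT => t0.
have xt : 0 < x + t by rewrite ltr_wpDr.
have -> : (x + t) `^ (- a) = (x + t) * (x + t) `^ (- (a + 1)).
  rewrite -[X in _ = X * _]powRr1 ?(ltW xt)// -gt0_powRD//.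
  by congr (_ `^ _); ring.
by rewrite exprSr; ring.
Qed.

End stieltjes_integral.

Lemma derive1n_cst (R : realType) (c : R) :
  smooth_on_pos (fun _ : R => c) /\
  forall (n : nat) (x : R), 0 < x ->
    derive1n n (fun _ : R => c) x = if n is 0 then c else 0.
Proof.
apply: (@is_derive_tower _ (fun n (_ : R) => if n is 0 then c else 0)).
Qed.

(** * Stieltjes functions and complete monotonicity *)

Section stieltjes_completely_monotonic.
Variable R : realType.
Variable mu : {measure set (measurableTypeR R) -> \bar R}.
Variables lam c : R.
Hypothesis lam0 : 0 < lam.
Hypothesis c0 : 0 <= c.
Hypothesis int_lam : forall x : R, 0 < x ->
  mu.-integrable `[0, +oo[ (fun t => ((x + t) `^ lam)^-1%:E).

Lemma derive1n_stieltjesDc k (a : R) : lam + k%:R <= a ->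
  smooth_on_pos (fun x => stieltjes_integral mu k a x + c) /\
  forall (n : nat) (x : R), 0 < x ->
    derive1n n (fun x => stieltjes_integral mu k a x + c) x =
    (-1) ^+ n * (\prod_(i < n) (a + i%:R)) * stieltjes_integral mu k (a + n%:R) x +
    (if n is 0 then c else 0).
Proof.
move=> ka; have [sS dS] := derive1n_stieltjes lam0 int_lam ka.
have [sc dc] := derive1n_cst c.
have [sSc dSc] := smoothD sS sc; split=> // n x x0.
by rewrite -(dS n x x0) -(dc n x x0); exact: dSc.
Qed.

Lemma completely_monotonic_stieltjes k (a P : R) : lam + k%:R <= a -> 0 <= P ->
  completely_monotonic (fun x => P * (stieltjes_integral mu k a x + c)).
Proof.
move=> ka P0; have a0 : 0 < a by rewrite (lt_le_trans _ ka)// ltr_wpDr.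
have [sS dS] := derive1n_stieltjesDc ka.
have [sP dP] := smoothZ P sS; split=> // n x x0.
rewrite dP// dS// mulrCA mulr_ge0// mulrDr addr_ge0//.
  rewrite !mulrA -exprD addnn -mul2n exprM sqrrN expr1n expr1n mul1r.
  rewrite mulr_ge0 ?stieltjes_integral_ge0 ?(ltW x0)// prodr_ge0// => i _.
  by rewrite addr_ge0// ltW.
by case: n => [|n]; rewrite ?expr0 ?mul1r ?mulr0.
Qed.

(** Write I(k, a) for the integral and a = lam + k. The recursion [c_opS] turns I(k, a) + c into a
    (I(k, a) - x I(k, a+1) + c), and the bracket is I(k+1, a+1) + c. *)
Lemma c_op_stieltjes (f : R -> R) k (x : R) : smooth_on_pos f ->
  (forall x, 0 < x -> f x = stieltjes_integral mu 0 lam x + c) -> 0 < x ->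
  c_op lam k f x =
  (\prod_(i < k) (lam + i%:R)) * (stieltjes_integral mu k (lam + k%:R) x + c).
Proof.
move=> sf fE; elim: k x => [|k IHk] x x0.
  by rewrite c_op0// big_ord0 mul1r addr0 fE.
rewrite c_opS//.
have ka : lam + k%:R <= lam + k%:R by [].
have [sS dS] := derive1n_stieltjesDc ka.
have [_ dP] := smoothZ (\prod_(i < k) (lam + i%:R)) sS.
have -> : derive1 (c_op lam k f) x = derive1n 1 (fun x =>
    (\prod_(i < k) (lam + i%:R)) * (stieltjes_integral mu k (lam + k%:R) x + c)) x.
  exact: (@eq_pos_derive1n _ _ _ IHk 1%N).
rewrite dP// dS// IHk// big_ord1 big_ord_recr/=.
have -> : lam + k.+1%:R = lam + k%:R + 1 by rewrite -natr1 addrA.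
rewrite (stieltjes_integralS int_lam ka x0).
by rewrite !addr0 expr1; ring.
Qed.

End stieltjes_completely_monotonic.

(** * The implications between the three conditions *)

Lemma generalized_stieltjes_c_op (R : realType) (lam : R) (f : R -> R) k :
  0 < lam -> smooth_on_pos f -> generalized_stieltjes lam f ->
  completely_monotonic (c_op lam k f).
Proof.
move=> lam0 sf [mu [c [c0 H]]].
have int_lam x (x0 : 0 < x) := (H x x0).1.
have fE x : 0 < x -> f x = stieltjes_integral mu 0 lam x + c.
  move=> x0; rewrite (H x x0).2; congr (_ + _); apply: eq_Rintegral => t _.
  by rewrite expr0 mul1r powRN.
have kk : lam + k%:R <= lam + k%:R by [].
have P0 : 0 <= \prod_(i < k) (lam + i%:R).
  by apply: prodr_ge0 => i _; rewrite addr_ge0// ltW.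
have [_ cm] := completely_monotonic_stieltjes lam0 c0 int_lam kk P0.
split=> [|n x x0]; first exact: smooth_c_op.
rewrite (eq_pos_derive1n _ n x0 (g := fun x => (\prod_(i < k) (lam + i%:R)) *
  (stieltjes_integral mu k (lam + k%:R) x + c))); first exact: cm.
by move=> y y0; exact: c_op_stieltjes.
Qed.

Lemma T_op_ge0_generalized_stieltjes (R : realType) (lam : R) (f : R -> R) :
  0 < lam -> smooth_on_pos f ->
  (forall n k x, 0 < x -> 0 <= T_op lam n k f x) ->
  generalized_stieltjes lam f.
Proof.
move=> lam0 sf T0.
have TE n (x : R) : 0 < x -> T_op lam n 0 f x = (-1) ^+ n * derive1n n f x.
  move=> x0; rewrite T_opE//; congr (_ * _).
  by apply: eq_pos_derive1n x0 => y y0; exact: c_op0.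
have cmf : completely_monotonic f by split=> // n x x0; rewrite -TE//; exact: T0.
pose P n : R := \prod_(i < n) (lam + i%:R).
have P0 n : 0 < P n by apply: prodr_gt0 => i _; rewrite ltr_wpDr.
pose h n k := T_op lam n k f 1 / P (n + k)%N.
have h0 n k : 0 <= h n k by rewrite divr_ge0 ?T0// ltW.
have hS n k : h n k = h n.+1 k + h n k.+1.
  have PS : P (n + k).+1 = P (n + k)%N * (lam + (n + k)%:R).
    by rewrite /P big_ord_recr.
  rewrite /h T_opS// addnS addSn PS mul1r.
  have p0 : P (n + k)%N != 0 by rewrite gt_eqF.
  have l0 : lam + (n + k)%:R != 0 by rewrite gt_eqF// ltr_wpDr.
  move: (lam + (n + k)%:R) l0 => s s0.
  by field; rewrite p0 s0.
have [q [qm q01 qh]] := hausdorff_moment h0 hS.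
have [mu [c [c0 H]]] := stieltjes_measure_of_moments (h 0 0) lam0 qm q01.
have int_lam x : 0 < x ->
    mu.-integrable `[0, +oo[ (fun t => ((x + t) `^ lam)^-1%:E).
  move=> x0; have := (H 0).1; rewrite addr0 => int1.
  (* The moments give integrability at x = 1 only; x + t >= y (1 + t) carries it to every x > 0. *)
  pose y := Num.min 1 x.
  have y0 : 0 < y by rewrite lt_min ltr01.
  have mD : measurable (`[0, +oo[%classic : set (measurableTypeR R)).
    exact: measurable_itv.
  have := integrableZl mD (y `^ (- lam)) int1.
  apply: le_integrable => //.
    by apply/measurable_EFinP/measurable_funTS; exact: measurable_powRV.
  move=> t; rewrite /= in_itv/= andbT => t0; rewrite lee_fin.
  rewrite !ger0_norm ?mulr_ge0 ?invr_ge0 ?powR_ge0// -!powRN -powRM ?(ltW y0)//.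
    apply: powRN_le; rewrite ?(ltW lam0)//.
      by rewrite mulr_gt0// ltr_wpDr.
    have [y1 yx] : y <= 1 /\ y <= x by rewrite !ge_min !lexx orbT.
    by rewrite mulrDr mulr1 lerD// ler_piMl.
  by rewrite addr_ge0.
exists mu, c; split=> // x x0; split; first exact: int_lam.
have ll : lam + 0%:R <= lam by rewrite addr0.
have cmF := completely_monotonic_stieltjes lam0 c0 int_lam ll ler01.
have [sS dS] := derive1n_stieltjesDc c lam0 int_lam ll.
have [_ d1] := smoothZ 1 sS.
rewrite (completely_monotonic_eq cmf cmF _ x0) => [|n].
  rewrite mul1r; congr (_ + _); apply: eq_Rintegral => t _.
  by rewrite expr0 mul1r powRN.
rewrite d1// mul1r dS//.
(* After multiplication by the sign, the left side is T_{n,0} f (1) = (lam)_n [h n 0], and the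
   moment formula splits [h n 0] into the integral at x = 1 and the constant. *)
apply: (@mulfI _ ((-1) ^+ n)); first by rewrite signr_eq0.
rewrite -TE// mulrDr !mulrA -exprD addnn -mul2n exprM sqrrN expr1n expr1n mul1r.
have -> : T_op lam n 0 f 1 = P n * h n 0.
  by rewrite /h addn0 mulrC divfK// gt_eqF.
rewrite -qh (H n).2 mulrDr -/(P n); congr (_ * _ + _).
  by apply: eq_Rintegral => t _; rewrite expr0 mul1r powRN.
by case: n => [|n]; rewrite ?mulr0// /P big_ord0 expr0.
Qed.

Theorem corollary1p4 (R : realType) (lambda : R) (f : R -> R) :
  0 < lambda -> smooth_on_pos f ->
  [<-> generalized_stieltjes lambda f;
       forall k : nat, completely_monotonic (c_op lambda k f);
       forall (n k : nat) (x : R), 0 < x -> 0 <= T_op lambda n k f x].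
Proof.
move=> lambda0 sf; tfae.
- by move=> fS k; exact: generalized_stieltjes_c_op.
- by move=> cm n k x x0; rewrite T_opE//; have [_] := cm k; exact.
- exact: T_op_ge0_generalized_stieltjes.
Qed.
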